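(* Consider the traffic shaping game (SCPF) and static slicing (SS) admission control defined in the context (homogeneous base stations, high overall slice loads), and assume the saturated regime defined there. Suppose that $\frac1B\mathbf1\in\Gamma^v$ for all $v\in\mathcal V$, where $\Gamma^v=\{\tilde{\boldsymbol\rho}^v\in\mathbb R^{\mathcal B}:\langle\mathbf 1,\tilde{\boldsymbol\rho}^v\rangle=1,\ \boldsymbol M^v\tilde{\boldsymbol\rho}^v\succeq\boldsymbol0\}$. Let $\rho^{v,*}=1/x_v^*$ be the carried load of slice $v$ at the Nash equilibrium of the traffic shaping game and $\rho^{v,SS,*}$ its optimal carried load under SS. Then the gain in total carried load is $$G_v^{\rm load}:=\frac{\rho^{v,*}}{\rho^{v,SS,*}}=\frac{s^v\tilde d_v-s^v}{s^v\tilde d_v-1}\ge1,\qquad\forall v\in\mathcal V.$$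
   Context: $\mathcal B$ (base stations, $|\mathcal B|=B$) and $\mathcal V$ (slices, the players) are finite nonempty sets. Each slice $v$ has a share $s^v>0$ with $\sum_v s^v=1$; a normalized mean-delay (BTD) requirement $\tilde d_v=d_v/\delta_v$ with $s^v\tilde d_v>1$ (base stations are homogeneous: the mean reciprocal capacity $\delta_v$ of slice $v$ is the same at every base station); arrival rates $\gamma_b^v>0$; mean sojourn times $\mu_b^v>0$; and a substochastic routing matrix $\boldsymbol Q^v$ such that customers eventually leave the network (so $\boldsymbol I-(\boldsymbol Q^v)^T$ is invertible with inverse $\sum_{k\ge0}((\boldsymbol Q^v)^T)^k$). Put $\boldsymbol M^v=\mathrm{diag}(\boldsymbol\gamma^v)^{-1}(\boldsymbol I-(\boldsymbol Q^v)^T)\mathrm{diag}(\boldsymbol\mu^v)^{-1}$. A relative load $\tilde{\boldsymbol\rho}^v$ and overall carried load $\rho^v>0$ correspond to the admission probabilities $\boldsymbol a^v=\rho^v\boldsymbol M^v\tilde{\boldsymbol\rho}^v$. Traffic shaping game (SCPF sharing, high-load form of the BTD constraint). A strategy of slice $v$ is $\boldsymbol y^v=(\tilde{\boldsymbol\rho}^v,x_v)\in\mathbb R^{\mathcal B}\times\mathbb R$, $x_v=1/\rho^v$. Given the others' strategies $\boldsymbol y^{-v}$, slice $v$ minimizes $x_v$ over $$Y^v(\boldsymbol y^{-v})=\{\boldsymbol y^v:\langle\mathbf 1,\tilde{\boldsymbol\rho}^v\rangle=1,\ \boldsymbol0\preceq\boldsymbol M^v\tilde{\boldsymbol\rho}^v\preceq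 x_v\mathbf1,\ \langle\tilde{\boldsymbol g},\tilde{\boldsymbol\rho}^v\rangle\le s^v(\tilde d_v-1)x_v\},\qquad\tilde{\boldsymbol g}=\sum_{w\in\mathcal V}s^w\tilde{\boldsymbol\rho}^w.$$ A Nash equilibrium is a profile $\boldsymbol y^*$ such that, for every $v$, $\boldsymbol y^{v,*}\in Y^v(\boldsymbol y^{-v,*})$ minimizes $x_v$ over $Y^v(\boldsymbol y^{-v,*})$. Admission control under SS. Slice $v$ maximizes $\rho^v$ over $(\tilde{\boldsymbol\rho}^v,\rho^v)$ subject to $\boldsymbol a^v=\rho^v\boldsymbol M^v\tilde{\boldsymbol\rho}^v\in[0,1]^B$, $\langle\mathbf1,\tilde{\boldsymbol\rho}^v\rangle=1$ and $\rho^v\|\tilde{\boldsymbol\rho}^v\|_2^2\le s^v\tilde d_v-1$. Saturated regime. For each slice $v$, the optimal admission control, both in the traffic shaping game (in response to any loads $\tilde{\boldsymbol\rho}^{w}\in\Gamma^w$, $w\ne v$, of the other slices) and under SS, satisfies $\boldsymbol a^v\prec\mathbf1$ (strictly, componentwise). *)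

(* Defs.v *)
From HB Require Import structures.
From mathcomp Require Import all_boot all_order all_algebra.
From mathcomp Require Import all_classical all_reals all_analysis.

Set Implicit Arguments.
Unset Strict Implicit.
Unset Printing Implicit Defensive.

Import Order.TTheory GRing.Theory Num.Theory.
Import numFieldNormedType.Exports.

Local Open Scope classical_set_scope.
Local Open Scope ring_scope.

(* Base stations are the indices ['I_n], slices the elements of [V].          *)
(* [btd v] is the mean-delay requirement of slice [v], [delta v] its mean     *)
(* reciprocal capacity, the same at every base station (homogeneity).         *)
(* [routing v b b'] is the probability that a customer of slice [v] moves     *)
(* from [b] to [b'].  Row [b] of its [k]-th power sums to the probability     *)
(* that a customer starting at [b] is still in the network after [k] moves,   *)
(* so [routing_leaves] says that customers eventually leave.                  *)
Record network (R : realType) (V : finType) (n : nat) := Network {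
  share : V -> R;
  btd : V -> R;
  delta : V -> R;
  arrival : V -> 'rV[R]_n;
  sojourn : V -> 'rV[R]_n;
  routing : V -> 'M[R]_n;
  stations_nonempty : (0 < n)%N;
  slices_nonempty : (0 < #|V|)%N;
  share_gt0 : forall v, 0 < share v;
  share_sum1 : \sum_v share v = 1;
  delta_gt0 : forall v, 0 < delta v;
  btd_large : forall v, 1 < share v * (btd v / delta v);
  arrival_gt0 : forall v b, 0 < arrival v 0 b;
  sojourn_gt0 : forall v b, 0 < sojourn v 0 b;
  routing_ge0 : forall v b b', 0 <= routing v b b';
  routing_le1 : forall v b, \sum_b' routing v b b' <= 1;
  routing_leaves : forall v b,
    (fun k : nat => \sum_b' (routing v ^+ k) b b') @ \oo --> (0 : R)
}.

Definition nbtd (R : realType) (V : finType) (n : nat) (N : network R V n)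
  (v : V) : R := btd N v / delta N v.

Definition load_mx (R : realType) (V : finType) (n : nat) (N : network R V n)
  (v : V) : 'M[R]_n :=
  invmx (diag_mx (arrival N v)) *m (1%:M - (routing N v)^T)
    *m invmx (diag_mx (sojourn N v)).

Definition dot (R : realType) (n : nat) (u w : 'cV[R]_n) : R :=
  \sum_b u b 0 * w b 0.

Definition cv_le (R : realType) (n : nat) (u w : 'cV[R]_n) : Prop :=
  forall b, u b 0 <= w b 0.

Definition cv_lt (R : realType) (n : nat) (u w : 'cV[R]_n) : Prop :=
  forall b, u b 0 < w b 0.

Definition admission (R : realType) (V : finType) (n : nat)
  (N : network R V n) (v : V) (r : 'cV[R]_n) (rho : R) : 'cV[R]_n :=
  rho *: (load_mx N v *m r).

Definition Gamma (R : realType) (V : finType) (n : nat) (N : network R V n)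
  (v : V) : set 'cV[R]_n :=
  [set r | dot (const_mx 1) r = 1 /\ cv_le 0 (load_mx N v *m r)].

(* A strategy is a pair (relative load, reciprocal of the carried load).      *)
Definition strategy (R : realType) (n : nat) : Type := ('cV[R]_n * R)%type.

Definition carried_load (R : realType) (n : nat) (z : strategy R n) : R :=
  z.2^-1.

Definition deviate (R : realType) (V : finType) (n : nat)
  (y : V -> strategy R n) (v : V) (z : strategy R n) : V -> strategy R n :=
  fun w => if w == v then z else y w.

Definition weighted_load (R : realType) (V : finType) (n : nat)
  (N : network R V n) (y : V -> strategy R n) : 'cV[R]_n :=
  \sum_w share N w *: (y w).1.

(* The value [y v] is irrelevant in [strategy_set N y v], as the weighted     *)
(* load is that of the profile in which [v] plays [z].                        *)
Definition strategy_set (R : realType) (V : finType) (n : nat)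
  (N : network R V n) (y : V -> strategy R n) (v : V) : set (strategy R n) :=
  [set z | [/\ dot (const_mx 1) z.1 = 1,
               cv_le 0 (load_mx N v *m z.1),
               cv_le (load_mx N v *m z.1) (z.2 *: const_mx 1) &
               dot (weighted_load N (deviate y v z)) z.1
                 <= share N v * (nbtd N v - 1) * z.2]].

Definition best_response (R : realType) (V : finType) (n : nat)
  (N : network R V n) (y : V -> strategy R n) (v : V) (z : strategy R n)
  : Prop :=
  strategy_set N y v z /\ forall z', strategy_set N y v z' -> z.2 <= z'.2.

Definition nash_equilibrium (R : realType) (V : finType) (n : nat)
  (N : network R V n) (y : V -> strategy R n) : Prop :=
  forall v, best_response N y v (y v).

(* Static slicing: the pairs are (relative load, carried load itself).        *)
Definition ss_set (R : realType) (V : finType) (n : nat) (N : network R V n)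
  (v : V) : set ('cV[R]_n * R) :=
  [set p | [/\ cv_le 0 (admission N v p.1 p.2),
               cv_le (admission N v p.1 p.2) (const_mx 1),
               dot (const_mx 1) p.1 = 1 &
               p.2 * dot p.1 p.1 <= share N v * nbtd N v - 1]].

Definition ss_optimal (R : realType) (V : finType) (n : nat)
  (N : network R V n) (v : V) (p : 'cV[R]_n * R) : Prop :=
  ss_set N v p /\ forall p', ss_set N v p' -> p'.2 <= p.2.

Definition saturated (R : realType) (V : finType) (n : nat)
  (N : network R V n) : Prop :=
  forall v,
    (forall y : V -> strategy R n,
       (forall w, w != v -> Gamma N w (y w).1) ->
       forall z, best_response N y v z ->
       cv_lt (admission N v z.1 (carried_load z)) (const_mx 1)) /\
    (forall p, ss_optimal N v p ->
       cv_lt (admission N v p.1 p.2) (const_mx 1)).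

Definition load_gain (R : realType) (n : nat) (z : strategy R n)
  (p : 'cV[R]_n * R) : R := carried_load z / p.2.

(* Main.v *)
(* At an optimum with all admission probabilities below 1 only the delay
   constraint limits the load, so it is active and the relative load minimizes a
   convex quadratic cost over Gamma. Under SS the cost is the squared norm, whose
   minimizer under unit sum is the uniform load u. In the game the first-order
   condition of slice v in the direction of u reads <s_v r_v + g, u - r_v> >= 0
   with g the weighted load; weighting by s_v and summing over v gives
   sum_v s_v^2 (|r_v|^2 - 1/n) + (|g|^2 - 1/n) <= 0, where every term is
   nonnegative, hence r_v = u for all v. The active delay constraints then give
   both carried loads in closed form. *)
Require Import Defs.
From mathcomp Require Import all_boot all_order all_algebra.
From mathcomp Require Import all_classical all_reals all_analysis.
From mathcomp Require Import ring lra.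

Set Implicit Arguments.
Unset Strict Implicit.
Unset Printing Implicit Defensive.

Import Order.TTheory GRing.Theory Num.Theory.
Import numFieldNormedType.Exports.
Local Open Scope ring_scope.

(** * Bilinearity and definiteness of the inner product *)

Lemma dotC (R : realType) (n : nat) (u w : 'cV[R]_n) : dot u w = dot w u.
Proof. by apply: eq_bigr => b _; rewrite mulrC. Qed.

Lemma dotDl (R : realType) (n : nat) (u v w : 'cV[R]_n) :
  dot (u + v) w = dot u w + dot v w.
Proof.
by rewrite /dot -big_split; apply: eq_bigr => b _; rewrite mxE mulrDl.
Qed.

Lemma dotZl (R : realType) (n : nat) (a : R) (u w : 'cV[R]_n) :
  dot (a *: u) w = a * dot u w.
Proof. by rewrite /dot mulr_sumr; apply: eq_bigr => b _; rewrite mxE mulrA. Qed.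

Lemma dotNl (R : realType) (n : nat) (u w : 'cV[R]_n) :
  dot (- u) w = - dot u w.
Proof. by rewrite -scaleN1r dotZl mulN1r. Qed.

Lemma dotDr (R : realType) (n : nat) (u v w : 'cV[R]_n) :
  dot w (u + v) = dot w u + dot w v.
Proof. by rewrite dotC dotDl !(dotC w). Qed.

Lemma dotZr (R : realType) (n : nat) (a : R) (u w : 'cV[R]_n) :
  dot w (a *: u) = a * dot w u.
Proof. by rewrite dotC dotZl dotC. Qed.

Lemma dotNr (R : realType) (n : nat) (u w : 'cV[R]_n) :
  dot w (- u) = - dot w u.
Proof. by rewrite dotC dotNl dotC. Qed.

Lemma dot0r (R : realType) (n : nat) (w : 'cV[R]_n) : dot w 0 = 0.
Proof. by rewrite -(scale0r 0) dotZr mul0r. Qed.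

Lemma dot0l (R : realType) (n : nat) (w : 'cV[R]_n) : dot 0 w = 0.
Proof. by rewrite dotC dot0r. Qed.

Lemma dot_sumr (R : realType) (I : finType) (n : nat) (w : 'cV[R]_n)
    (f : I -> 'cV[R]_n) :
  dot w (\sum_i f i) = \sum_i dot w (f i).
Proof. exact: (big_morph (dot w) (fun u v => dotDr u v w) (dot0r w)). Qed.

Lemma dot_ge0 (R : realType) (n : nat) (u : 'cV[R]_n) : 0 <= dot u u.
Proof. by apply: sumr_ge0 => b _; rewrite -expr2 sqr_ge0. Qed.

Lemma dot_eq0 (R : realType) (n : nat) (u : 'cV[R]_n) : dot u u = 0 -> u = 0.
Proof.
move=> u0; apply/colP => b; rewrite mxE; apply/eqP.
rewrite -sqrf_eq0 expr2; apply/eqP.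
by apply: (psumr_eq0P _ u0) => // i _; rewrite -expr2 sqr_ge0.
Qed.

Lemma scale_onesE (R : realType) (n : nat) (x : R) b :
  (x *: const_mx 1 : 'cV[R]_n) b 0 = x.
Proof. by rewrite !mxE mulr1. Qed.

(** * The uniform load as least-norm vector of unit sum *)

Definition uniform_load (R : realType) (n : nat) : 'cV[R]_n :=
  const_mx n%:R^-1.

Section UniformLoad.
Context {R : realType} {n : nat}.
Hypothesis n_gt0 : (0 < n)%N.
Implicit Type r : 'cV[R]_n.

Lemma dot_uniform r :
  dot (const_mx 1) r = 1 -> dot (uniform_load R n) r = n%:R^-1.
Proof.
move=> r1; have -> : uniform_load R n = n%:R^-1 *: const_mx 1.
  by apply/colP => b; rewrite !mxE mulr1.
by rewrite dotZl r1 mulr1.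
Qed.

Lemma dot1_uniform : dot (const_mx 1) (uniform_load R n) = 1.
Proof.
rewrite /dot; under eq_bigr do rewrite !mxE mul1r.
by rewrite sumr_const card_ord -[LHS]mulr_natr mulVf // pnatr_eq0 -lt0n.
Qed.

(** Both [<u, r>] and [<u, u>] equal 1/n for the uniform load [u]. Minimality and uniqueness of [u]
    are read off this squared distance. *)
Lemma dot_sub_uniform r : dot (const_mx 1) r = 1 ->
  dot (r - uniform_load R n) (r - uniform_load R n) = dot r r - n%:R^-1.
Proof.
move=> r1; rewrite !(dotDl, dotDr, dotNl, dotNr) (dotC r).
by rewrite !dot_uniform ?dot1_uniform //; ring.
Qed.

Lemma uniform_minimizes r :
  dot (const_mx 1) r = 1 -> n%:R^-1 <= dot r r.
Proof. by move=> r1; rewrite -subr_ge0 -dot_sub_uniform // dot_ge0. Qed.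

Lemma uniform_unique r :
  dot (const_mx 1) r = 1 -> dot r r <= n%:R^-1 -> r = uniform_load R n.
Proof.
move=> r1 rr; apply/eqP; rewrite -subr_eq0; apply/eqP/dot_eq0.
by rewrite dot_sub_uniform //; apply/eqP; rewrite subr_eq0 eq_le rr uniform_minimizes.
Qed.

End UniformLoad.

(** * Minimal reciprocal load under a quadratic delay cost *)

Lemma small_step (R : realFieldType) (I : finType) (c d : I -> R) :
  (forall i, 0 < c i) ->
  exists2 t0, 0 < t0 <= 1 & forall t, 0 <= t <= t0 -> forall i, t * d i < c i.
Proof.
move=> c_gt0.
have den_gt0 i : 0 < `|d i| + 1 by rewrite ltr_wpDl.
(* The default 1 caps the step, and the added 1 in the denominator makes the inequality strict for t
   > 0. *)
exists (\big[Order.min/1]_i (c i / (`|d i| + 1))).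
  by rewrite bigmin_le_id lt_bigmin // => i _; rewrite divr_gt0.
move=> t /andP[t0 tle] i.
have /(le_trans tle) : \big[Order.min/1]_i (c i / (`|d i| + 1))
    <= c i / (`|d i| + 1) by exact: bigmin_le_cond.
rewrite ler_pdivlMr // mulrDr mulr1 => tc.
move: t0 tc; rewrite le_eqVlt => /predU1P[<- _|t_gt0 tc]; first by rewrite mul0r.
apply: lt_le_trans tc; rewrite ltr_pwDr // ler_pM2l //; exact: ler_norm.
Qed.

(** Common form of both delay constraints: [alpha] is the share and [h] the others' weighted load in
    the game; [alpha = 1] and [h = 0] under static slicing. *)
Definition shaping_cost {R : realType} {n : nat} (alpha : R) (h r : 'cV[R]_n) : R :=
  alpha * dot r r + dot h r.

Section Shaping.
Context {R : realType} {n : nat}.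
Variables (M : 'M[R]_n) (alpha kappa : R) (h r : 'cV[R]_n) (x : R).
Hypothesis kappa_gt0 : 0 < kappa.
Hypothesis r_sum1 : dot (const_mx 1) r = 1.
Hypothesis Mr_ge0 : cv_le 0 (M *m r).
Hypothesis Mr_lt : cv_lt (M *m r) (x *: const_mx 1).
Hypothesis cost_le : shaping_cost alpha h r <= kappa * x.
Hypothesis x_min : forall r' x', dot (const_mx 1) r' = 1 ->
  cv_le 0 (M *m r') -> cv_le (M *m r') (x' *: const_mx 1) ->
  shaping_cost alpha h r' <= kappa * x' -> x <= x'.

Lemma shaping_no_slack (r' : 'cV[R]_n) : dot (const_mx 1) r' = 1 ->
  cv_le 0 (M *m r') -> cv_lt (M *m r') (x *: const_mx 1) ->
  kappa * x <= shaping_cost alpha h r'.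
Proof.
move=> r'1 r'0 r'x; rewrite leNgt; apply/negP => r'k.
(* With slack in every constraint, the largest of their lower bounds on the reciprocal load is a
   feasible value below the optimum [x]. *)
pose lo : R := Num.max (shaping_cost alpha h r' / kappa) (x - 1).
pose x' := \big[Order.max/lo]_b (M *m r') b 0.
have x'x : x' < x.
  apply: bigmax_lt => [|b _]; last by have := r'x b; rewrite scale_onesE.
  by rewrite /lo gt_max ltr_pdivrMr // mulrC r'k ltrBlDr ltrDl ltr01.
have : x <= x'.
  apply: (x_min r'1 r'0) => [b|].
    by rewrite scale_onesE; exact: (le_bigmax lo (fun i => (M *m r') i 0)).
  rewrite -ler_pdivrMl // mulrC; apply: le_trans (bigmax_ge_id _ _ _ _).
  by rewrite /lo le_max lexx.
by rewrite leNgt x'x.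
Qed.

Lemma shaping_active : shaping_cost alpha h r = kappa * x.
Proof. by apply/eqP; rewrite eq_le cost_le shaping_no_slack. Qed.

(** If the slope towards [r'] were negative, a short step would lower the cost and keep the capacity
    constraints strict, contradicting [shaping_no_slack]. *)
Lemma shaping_first_order (r' : 'cV[R]_n) : dot (const_mx 1) r' = 1 ->
  cv_le 0 (M *m r') -> 0 <= dot ((2 * alpha) *: r + h) (r' - r).
Proof.
move=> r'1 r'0; rewrite leNgt; apply/negP => slope_lt0.
set e := r' - r in slope_lt0.
have [|t1 /andP[t1_gt0 t1_le1] t1P] := @small_step R 'I_n
    (fun b => x - (M *m r) b 0) (fun b => (M *m e) b 0).
  by move=> b; rewrite subr_gt0; have := Mr_lt b; rewrite scale_onesE.
(* Below [t2] the quadratic term of the cost change cannot offset the negative slope. *)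
have [|t2 /andP[t2_gt0 _] t2P] := @small_step R unit
    (fun=> - dot ((2 * alpha) *: r + h) e) (fun=> alpha * dot e e).
  by move=> _; rewrite oppr_gt0.
pose t := Num.min t1 t2.
have t_gt0 : 0 < t by rewrite lt_min t1_gt0 t2_gt0.
have t_le1 : t <= 1 by rewrite ge_min t1_le1.
have Mt : M *m (r + t *: e) = (1 - t) *: (M *m r) + t *: (M *m r').
  rewrite mulmxDr -scalemxAr mulmxBr scalerBr scalerBl scale1r -addrA.
  by congr (_ + _); rewrite addrC.
have : kappa * x <= shaping_cost alpha h (r + t *: e).
  apply: shaping_no_slack => [|b|b].
  - by rewrite dotDr dotZr dotDr dotNr r_sum1 r'1 subrr mulr0 addr0.
  - rewrite Mt !mxE; apply: addr_ge0; apply: mulr_ge0; rewrite ?subr_ge0 ?(ltW t_gt0) //.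
    + by have := Mr_ge0 b; rewrite !mxE.
    + by have := r'0 b; rewrite !mxE.
  - have := t1P t _ b; rewrite (ltW t_gt0) ge_min lexx => /(_ isT).
    have -> : (M *m (r + t *: e)) b 0 = (M *m r) b 0 + t * (M *m e) b 0.
      by rewrite [M *m (r + _)]mulmxDr -scalemxAr [LHS]mxE; congr (_ + _); rewrite mxE.
    by rewrite scale_onesE ltrBrDl.
rewrite leNgt => /negP; apply; apply: lt_le_trans cost_le.
have -> : shaping_cost alpha h (r + t *: e) = shaping_cost alpha h r
    + t * (dot ((2 * alpha) *: r + h) e + t * (alpha * dot e e)).
  move: (e) => d; rewrite /shaping_cost !(dotDl, dotDr, dotZl, dotZr) (dotC d r).
  by ring.
rewrite gtrDl pmulr_rlt0 // -ltrBrDl sub0r; apply: (t2P _ _ tt).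
by rewrite (ltW t_gt0) ge_min lexx orbT.
Qed.

End Shaping.

(** * Injectivity of the load matrix *)

Section LoadMatrix.
Context {R : realType} {n : nat}.

Lemma exprmx_ge0 (Q : 'M[R]_n) (k : nat) : (forall b b', 0 <= Q b b') ->
  forall b b', 0 <= (Q ^+ k) b b'.
Proof.
move=> Q0; elim: k => [|k IHk] b b'.
  by rewrite expr0 mxE ler0n.
by rewrite exprSr -mulmxE mxE; apply: sumr_ge0 => i _; rewrite mulr_ge0.
Qed.

(** Since [w = w Q^k] for all k, the l1 norm of [w] is at most the row sums of [Q^k] weighted by
    [|w|], which tend to 0. *)
Lemma transient_fixpoint (Q : 'M[R]_n) (w : 'rV[R]_n) :
  (forall b b', 0 <= Q b b') ->
  (forall b, ((fun k : nat => \sum_b' (Q ^+ k) b b') @ \oo --> (0 : R))%classic) ->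
  w *m Q = w -> w = 0.
Proof.
move=> Q0 Qlim wQ.
have wQk k : w *m (Q ^+ k) = w.
  elim: k => [|k IHk]; first by rewrite expr0 mulmx1.
  by rewrite exprSr -mulmxE mulmxA IHk.
have mass_le k : \sum_b `|w 0 b|
    <= \sum_b `|w 0 b| * (\sum_b' (Q ^+ k) b b').
  under [leRHS]eq_bigr do rewrite mulr_sumr.
  rewrite exchange_big /=; apply: ler_sum => b _.
  rewrite -[in leLHS](wQk k) mxE; apply: le_trans (ler_norm_sum _ _ _) _.
  by apply: ler_sum => i _; rewrite normrM (ger0_norm (exprmx_ge0 _ _ _ _)).
have mass_le0 : \sum_b `|w 0 b| <= 0.
  have lim0 : ((fun k : nat => \sum_b `|w 0 b| * (\sum_b' (Q ^+ k) b b'))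
      @ \oo --> (\sum_(b < n) `|w 0 b| * 0 : R))%classic.
    by apply: cvg_big => [|b _]; [exact: add_continuous|apply: cvgMl_tmp; exact: Qlim].
  rewrite -mulr_suml mulr0 in lim0.
  apply: (ler_cvg_to (cvg_cst (\sum_b `|w 0 b|)) lim0).
  by apply: nearW => k; exact: mass_le.
have mass0 : \sum_b `|w 0 b| = 0.
  by apply/eqP; rewrite eq_le mass_le0 sumr_ge0.
apply/rowP => b; rewrite mxE; apply/eqP; rewrite -normr_eq0; apply/eqP.
exact: (psumr_eq0P _ mass0).
Qed.

Lemma diag_mx_unit (d : 'rV[R]_n) : (forall b, 0 < d 0 b) -> diag_mx d \in unitmx.
Proof.
move=> d0; rewrite unitmxE det_diag unitfE; apply/prodf_neq0 => b _.
by rewrite gt_eqF.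
Qed.

Lemma load_mx_inj (V : finType) (N : network R V n) (v : V) (r : 'cV[R]_n) :
  load_mx N v *m r = 0 -> r = 0.
Proof.
have aU := diag_mx_unit (arrival_gt0 N v).
have sU := diag_mx_unit (sojourn_gt0 N v).
rewrite /load_mx -!mulmxA => /(congr1 (mulmx (diag_mx (arrival N v)))).
rewrite mulKVmx // mulmx0 => /eqP; rewrite mulmxBl mul1mx subr_eq0 => /eqP fixed.
suff : (invmx (diag_mx (sojourn N v)) *m r)^T = 0.
  move=> /(congr1 trmx); rewrite trmxK trmx0.
  by move/(congr1 (mulmx (diag_mx (sojourn N v)))); rewrite mulKVmx // mulmx0.
apply: (transient_fixpoint (Q := routing N v)); first exact: routing_ge0.
  exact: routing_leaves.
by rewrite -[X in _ *m X]trmxK -trmx_mul -fixed.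
Qed.

End LoadMatrix.

(** * The delay constraint of the game as a quadratic cost *)

Section Equilibrium.
Context {R : realType} {V : finType} {n : nat} (N : network R V n).

Lemma share_le1 v : share N v <= 1.
Proof.
rewrite -(share_sum1 N) (bigD1 v) //= lerDl; apply: sumr_ge0 => w _.
exact/ltW/share_gt0.
Qed.

Lemma nbtd_gt1 v : 1 < nbtd N v.
Proof.
have := btd_large N v; have := share_le1 v; have := share_gt0 N v.
rewrite -/(nbtd N v) => s0 s1 sd.
have d0 : 0 < nbtd N v by rewrite -(pmulr_rgt0 _ s0) (lt_trans ltr01).
by apply: lt_le_trans sd _; rewrite ler_piMl // ltW.
Qed.

Definition others_load (y : V -> strategy R n) (v : V) : 'cV[R]_n :=
  \sum_(w | w != v) share N w *: (y w).1.

Lemma weighted_load_deviate y v z :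
  weighted_load N (deviate y v z) = share N v *: z.1 + others_load y v.
Proof.
rewrite /weighted_load (bigD1 v) //= /deviate eqxx; congr (_ + _).
by apply: eq_bigr => w /negPf ->.
Qed.

Lemma weighted_loadE y v :
  weighted_load N y = share N v *: (y v).1 + others_load y v.
Proof. by rewrite /weighted_load (bigD1 v). Qed.

Lemma cost_deviate y v z : dot (weighted_load N (deviate y v z)) z.1
  = shaping_cost (share N v) (others_load y v) z.1.
Proof. by rewrite weighted_load_deviate dotDl dotZl. Qed.

(** The bounds on [M r] give [x >= 0]; [x = 0] would force [M r = 0], hence [r = 0] by injectivity,
    against the unit sum. *)
Lemma strategy_set_gt0 y v z : strategy_set N y v z -> 0 < z.2.
Proof.
case=> z1 z0 zx _; rewrite lt_neqAle; apply/andP; split.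
  apply/eqP => x0; suff r0 : z.1 = 0.
    by move: z1; rewrite r0 dot0r => /eqP; rewrite eq_sym oner_eq0.
  apply: (load_mx_inj (N := N) (v := v)); apply/colP => b; apply/eqP; rewrite eq_le.
  by rewrite (z0 b) andbT; have := zx b; rewrite -x0 scale0r.
have b := Ordinal (stations_nonempty N).
by have := le_trans (z0 b) (zx b); rewrite !mxE mulr1.
Qed.

Hypothesis hsat : saturated N.
Hypothesis hunif : forall v : V, Gamma N v (uniform_load R n).

Let n_gt0 := stations_nonempty N.

(** * Loads at a Nash equilibrium *)

Section Nash.
Variables (y : V -> strategy R n).
Hypothesis hy : nash_equilibrium N y.

Lemma nash_interior v :
  cv_lt (load_mx N v *m (y v).1) ((y v).2 *: const_mx 1).
Proof.
have others w : w != v -> Gamma N w (y w).1.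
  by move=> _; have [[]] := hy w.
move=> b; have := (hsat v).1 y others _ (hy v) b.
have x_gt0 := strategy_set_gt0 (hy v).1.
by rewrite /admission /carried_load [ltLHS]mxE !mxE ltr_pdivrMl // mulr1.
Qed.

Lemma nash_min v r' x' : dot (const_mx 1) r' = 1 ->
  cv_le 0 (load_mx N v *m r') -> cv_le (load_mx N v *m r') (x' *: const_mx 1) ->
  shaping_cost (share N v) (others_load y v) r'
    <= share N v * (nbtd N v - 1) * x' ->
  (y v).2 <= x'.
Proof.
move=> r'1 r'0 r'x r'k; apply: ((hy v).2 (r', x')).
by split=> //; rewrite cost_deviate.
Qed.

Lemma nash_first_order v :
  0 <= dot (share N v *: (y v).1 + weighted_load N y) (uniform_load R n - (y v).1).
Proof.
have [[r1 r0 _ rk] _] := hy v; rewrite cost_deviate in rk.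
have kappa_gt0 : 0 < share N v * (nbtd N v - 1).
  by rewrite mulr_gt0 ?share_gt0 ?subr_gt0 ?nbtd_gt1.
have := shaping_first_order kappa_gt0 r1 r0 (nash_interior v) rk
  (@nash_min v) (dot1_uniform n_gt0) (hunif v).2.
(* The gradient has [2 s_v r_v]; one copy joins the others' load to form the full weighted load. *)
by rewrite (weighted_loadE y v) addrA -scalerDl -mulr2n mulr_natl.
Qed.

Lemma nash_uniform v : (y v).1 = uniform_load R n.
Proof.
have sum1 w : dot (const_mx 1) (y w).1 = 1 by have [[]] := hy w.
pose g := weighted_load N y.
have g1 : dot (const_mx 1) g = 1.
  rewrite dot_sumr -[RHS](share_sum1 N); apply: eq_bigr => w _.
  by rewrite dotZr sum1 mulr1.
(* Adding the players' first-order conditions with weights [share N w]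
   turns the coupling terms into [<g, u> - <g, g>]. *)
have : 0 <= \sum_w share N w * dot (share N w *: (y w).1 + g)
    (uniform_load R n - (y w).1).
  by apply: sumr_ge0 => w _; rewrite mulr_ge0 ?nash_first_order // ltW ?share_gt0.
have -> : \sum_w share N w * dot (share N w *: (y w).1 + g)
    (uniform_load R n - (y w).1) =
  - (\sum_w share N w ^+ 2 * (dot (y w).1 (y w).1 - n%:R^-1))
    - (dot g g - n%:R^-1).
  transitivity (\sum_w (- (share N w ^+ 2 * (dot (y w).1 (y w).1 - n%:R^-1))
      - (share N w * dot g (y w).1 - share N w * n%:R^-1))).
    apply: eq_bigr => w _.
    rewrite !(dotDl, dotDr, dotNr, dotZl) (dotC (y w).1) (dotC g (uniform_load _ _)).
    by rewrite !dot_uniform //; ring.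
  rewrite sumrB sumrN; congr (_ - _).
  rewrite sumrB -mulr_suml share_sum1 mul1r; congr (_ - _).
  rewrite {2}/g dot_sumr; apply: eq_bigr => w _.
  by rewrite dotZr.
have var_ge0 w : 0 <= share N w ^+ 2 * (dot (y w).1 (y w).1 - n%:R^-1).
  by rewrite mulr_ge0 ?sqr_ge0 // subr_ge0 uniform_minimizes.
have := uniform_minimizes n_gt0 g1; rewrite -subr_ge0 => g_ge total_ge0.
(* Minus two nonnegative quantities is nonnegative, so both vanish. *)
have total0 : \sum_w share N w ^+ 2 * (dot (y w).1 (y w).1 - n%:R^-1) = 0.
  have : 0 <= \sum_w share N w ^+ 2 * (dot (y w).1 (y w).1 - n%:R^-1).
    exact: sumr_ge0.
  lra.
have : share N v ^+ 2 * (dot (y v).1 (y v).1 - n%:R^-1) = 0.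
  exact: (psumr_eq0P (fun w _ => var_ge0 w) total0).
move/eqP; rewrite mulf_eq0 expf_eq0 /= gt_eqF ?share_gt0 //= subr_eq0 => /eqP rr.
by apply: uniform_unique => //; rewrite rr.
Qed.

Lemma nash_load v : carried_load (y v) = n%:R * (share N v * (nbtd N v - 1)).
Proof.
have [[r1 r0 _ rk] _] := hy v; rewrite cost_deviate in rk.
have kappa_gt0 : 0 < share N v * (nbtd N v - 1).
  by rewrite mulr_gt0 ?share_gt0 ?subr_gt0 ?nbtd_gt1.
have := shaping_active kappa_gt0 r1 r0 (nash_interior v) rk (@nash_min v).
(* The cost is [<g, u>] with [g] the weighted load, which has unit sum because the shares sum to
   1. *)
have -> : shaping_cost (share N v) (others_load y v) (y v).1 = n%:R^-1.
  rewrite /shaping_cost -dotZl -dotDl -weighted_loadE nash_uniform dotC.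
  apply: dot_uniform.
  rewrite dot_sumr -[RHS](share_sum1 N); apply: eq_bigr => w _.
  by rewrite dotZr nash_uniform dot1_uniform ?mulr1.
move=> kx; rewrite /carried_load.
by rewrite -[n%:R]invrK kx invfM mulrAC mulVf ?mul1r ?gt_eqF.
Qed.

End Nash.

(** * The optimum under static slicing *)

Section StaticSlicing.
Variables (v : V) (p : 'cV[R]_n * R).
Hypothesis hp : ss_optimal N v p.

Let kappa := share N v * nbtd N v - 1.

Let kappa_gt0 : 0 < kappa.
Proof. by rewrite subr_gt0 btd_large. Qed.

Lemma ss_gt0 : 0 < p.2.
Proof.
(* A small positive carried load with uniform relative load is feasible: [Some b] indexes the
   admission bound at [b], [None] the delay bound. *)
have [|t /andP[t_gt0 _] tP] := @small_step R (option 'I_n)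
  (fun o => if o is Some b then 1 else kappa)
  (fun o => if o is Some b then (load_mx N v *m uniform_load R n) b 0
            else dot (uniform_load R n) (uniform_load R n)).
  by case.
have tt : 0 <= t <= t by rewrite ltW //=.
apply: (lt_le_trans t_gt0); apply: (hp.2 (uniform_load R n, t)).
split=> [b|b||].
- have := (hunif v).2 b; rewrite [leLHS]mxE => Mu.
  by rewrite /admission /= [leLHS]mxE [leRHS]mxE mulr_ge0 // ltW.
- have /ltW Mu := tP t tt (Some b).
  by rewrite /admission /= [leRHS]mxE [leLHS]mxE.
- exact: dot1_uniform.
- exact: ltW (tP t tt None).
Qed.

Lemma ss_load : p.2 = n%:R * (share N v * nbtd N v - 1).
Proof.
have p_gt0 := ss_gt0; have [[p0 _ p1 pk] popt] := hp.
(* Passing to the reciprocal load turns maximization of the carried load into the shaping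
   problem. *)
pose x := p.2^-1; have x_gt0 : 0 < x by rewrite invr_gt0.
have Mr_ge0 : cv_le 0 (load_mx N v *m p.1).
  move=> b; have := p0 b; rewrite /admission [leLHS]mxE [leRHS]mxE pmulr_rge0 //.
  by move=> Mr; rewrite [leLHS]mxE.
have Mr_lt : cv_lt (load_mx N v *m p.1) (x *: const_mx 1).
  move=> b; have := (hsat v).2 _ hp b.
  by rewrite /admission [ltLHS]mxE [ltRHS]mxE scale_onesE -ltr_pdivlMl // mulr1.
have cost_le : shaping_cost 1 0 p.1 <= kappa * x.
  by rewrite /shaping_cost mul1r dot0l addr0 ler_pdivlMr // mulrC.
have x_min r' x' : dot (const_mx 1) r' = 1 -> cv_le 0 (load_mx N v *m r') ->
    cv_le (load_mx N v *m r') (x' *: const_mx 1) ->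
    shaping_cost 1 0 r' <= kappa * x' -> x <= x'.
  rewrite /shaping_cost mul1r dot0l addr0 => r'1 r'0 r'x r'k.
  (* The cost is at least 1/n, which keeps [x'] positive and hence invertible. *)
  have x'_gt0 : 0 < x'.
    rewrite -(pmulr_rgt0 _ kappa_gt0); apply: lt_le_trans r'k.
    by apply: lt_le_trans (uniform_minimizes n_gt0 r'1); rewrite invr_gt0 ltr0n.
  rewrite /x -[x']invrK lef_pV2 ?posrE ?invr_gt0 //.
  apply: (popt (r', x'^-1)); split=> //= [b|b|].
  - have := r'0 b; rewrite [leLHS]mxE => Mr'.
    by rewrite /admission [leLHS]mxE [leRHS]mxE mulr_ge0 // invr_ge0 ltW.
  - have := r'x b; rewrite scale_onesE => Mr'.
    by rewrite /admission [leLHS]mxE [leRHS]mxE ler_pdivrMl // mulr1.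
  - by rewrite ler_pdivrMl // mulrC.
(* The first-order condition towards [u] reads [2 (1/n - |r|^2) >= 0]. *)
have pu : p.1 = uniform_load R n.
  have := shaping_first_order kappa_gt0 p1 Mr_ge0 Mr_lt cost_le x_min
    (dot1_uniform n_gt0) (hunif v).2.
  rewrite addr0 mulr1 dotZl dotDr dotNr (dotC p.1) dot_uniform // => ?.
  by apply: uniform_unique => //; lra.
have := shaping_active kappa_gt0 p1 Mr_ge0 Mr_lt cost_le x_min.
rewrite /shaping_cost mul1r dot0l addr0 pu.
rewrite dot_uniform ?dot1_uniform // -/kappa => kx.
by rewrite -[n%:R]invrK kx invfM invrK mulrAC mulVf ?mul1r ?gt_eqF.
Qed.

End StaticSlicing.

End Equilibrium.

(** * The gain in total carried load *)

Theorem corollary4 (R : realType) (V : finType) (n : nat) (N : network R V n)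
  (hsat : saturated N)
  (hunif : forall v : V, Gamma N v (const_mx (n%:R^-1)))
  (y : V -> strategy R n) (hy : nash_equilibrium N y)
  (p : V -> 'cV[R]_n * R) (hp : forall v : V, ss_optimal N v (p v)) :
  forall v : V,
    load_gain (y v) (p v)
      = (share N v * nbtd N v - share N v) / (share N v * nbtd N v - 1) /\
    1 <= load_gain (y v) (p v).
Proof.
move=> v.
have kappa_gt0 : 0 < share N v * nbtd N v - 1 by rewrite subr_gt0 btd_large.
have n_neq0 : n%:R != 0 :> R by rewrite pnatr_eq0 -lt0n (stations_nonempty N).
have gain : load_gain (y v) (p v)
    = (share N v * nbtd N v - share N v) / (share N v * nbtd N v - 1).
  rewrite /load_gain (nash_load hsat hunif hy) (ss_load hsat hunif (hp v)).
  by rewrite -mulf_div divff // mul1r mulrBr mulr1.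
(* The gain is at least 1 because a share is at most 1. *)
by rewrite gain; split=> //; rewrite ler_pdivlMr // mul1r lerB ?share_le1.
Qed.
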